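(* (1) For any integers $p\ge 0$ and $k\ge p+2$ there exists $n_0(k,p)$ such that $\beta_{p,1}(n,k)=\binom{n-3-p}{k-2-p}$ for all $n\ge n_0(k,p)$. (2) For any integers $p\ge 0$ and $k\ge p+3$ there exists $n_0(k,p)$ such that $\beta_{p,2}(n,k)=2\binom{n-5-p}{k-3-p}-\binom{n-7-p}{k-5-p}$ for all $n\ge n_0(k,p)$.
   Context: $[n]=\{1,\dots,n\}$ and $\binom{[n]}{k}$ is the family of all $k$-subsets of $[n]$. A family $\mathcal{F}$ is intersecting if $F\cap F'\neq\emptyset$ for all $F,F'\in\mathcal{F}$. For a family $\mathcal{F}$ and disjoint sets $A,B$, let $\mathcal{F}(A,\overline{B})=\{F\in\mathcal{F}: A\subseteq F,\ B\cap F=\emptyset\}$. For $\mathcal{F}\subseteq 2^{[n]}$, $\beta_{p,q}(\mathcal{F})=\min\{|\mathcal{F}(A,\overline{B})|: |A|=p,\ |B|=q,\ A\cap B=\emptyset,\ A,B\subseteq[n]\}$, and $\beta_{p,q}(n,k)=\max\{\beta_{p,q}(\mathcal{F}): \mathcal{F}\subseteq\binom{[n]}{k},\ \mathcal{F}\text{ intersecting}\}$. Binomial coefficients $\binom{a}{b}$ with $b<0$ are $0$. *)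

(* Defs.v *)
From mathcomp Require Import all_boot all_order all_algebra.

Set Implicit Arguments.
Unset Strict Implicit.
Unset Printing Implicit Defensive.

(* The ground set [n] is encoded as 'I_n = {0, ..., n-1}. *)

(* Taking F = F' excludes the empty set from an intersecting family. *)
Definition intersecting (n : nat) (Fam : {set {set 'I_n}}) : bool :=
  [forall F in Fam, forall F' in Fam, F :&: F' != set0].

Definition uniform (n k : nat) (Fam : {set {set 'I_n}}) : bool :=
  [forall F in Fam, #|F| == k].

(* The family F(A, \overline{B}). *)
Definition restr (n : nat) (Fam : {set {set 'I_n}}) (A B : {set 'I_n}) :
    {set {set 'I_n}} :=
  [set F in Fam | (A \subset F) && (B :&: F == set0)].

Definition admissible (n p q : nat) (AB : {set 'I_n} * {set 'I_n}) : bool :=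
  [&& #|AB.1| == p, #|AB.2| == q & AB.1 :&: AB.2 == set0].

(* The initial value #|Fam| bounds every term, so it does not affect the
   minimum as soon as an admissible pair exists (see beta_famP). *)
Definition beta_fam (n p q : nat) (Fam : {set {set 'I_n}}) : nat :=
  \big[minn/#|Fam|]_(AB | admissible p q AB) #|restr Fam AB.1 AB.2|.

Definition beta (p q n k : nat) : nat :=
  \max_(Fam : {set {set 'I_n}} | uniform k Fam && intersecting Fam)
    beta_fam p q Fam.

(* Binomial coefficient with the convention that it is 0 when b < 0. *)
Definition binz (a : nat) (b : int) : int :=
  if b is Posz m then Posz 'C(a, m) else Posz 0.

Lemma admissible_exists (n p q : nat) :
  p + q <= n -> exists AB : {set 'I_n} * {set 'I_n}, admissible p q AB.
Proof.
move=> le_pq_n.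
have subcard (T : finType) (D : {set T}) m :
    m <= #|D| -> exists2 A : {set T}, A \subset D & #|A| = m.
  move=> le_m; have : 0 < #|[set A : {set T} | A \subset D & #|A| == m]|.
    by rewrite cards_draws bin_gt0.
  by case/card_gt0P=> A; rewrite inE => /andP[sA /eqP cA]; exists A.
have [|A _ cA] := subcard _ [set: 'I_n] p.
  by rewrite cardsT card_ord (leq_trans (leq_addr q p)).
have [|B sB cB] := subcard _ (~: A) q.
  by rewrite cardsCs setCK card_ord cA leq_subRL // (leq_trans (leq_addr q p)).
exists (A, B); rewrite /admissible /= cA cB !eqxx /=.
by rewrite setI_eq0 disjoint_sym disjoints_subset.
Qed.

Lemma beta_famP (n p q : nat) (Fam : {set {set 'I_n}}) :
  p + q <= n ->
  (exists2 AB, admissible p q AB & beta_fam p q Fam = #|restr Fam AB.1 AB.2|)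
  /\ (forall AB, admissible p q AB -> beta_fam p q Fam <= #|restr Fam AB.1 AB.2|).
Proof.
move=> /admissible_exists[AB0 adm0].
have lb AB : admissible p q AB -> beta_fam p q Fam <= #|restr Fam AB.1 AB.2|.
  move=> adm; rewrite /beta_fam; have := mem_index_enum AB.
  elim: (index_enum _) => //= X s IHs.
  rewrite inE big_cons => /orP[/eqP <-|/IHs le_s]; first by rewrite adm geq_minl.
  by case: ifP => // _; apply: leq_trans (geq_minr _ _) le_s.
split=> //.
have: beta_fam p q Fam = #|Fam| \/
    exists2 AB, admissible p q AB & beta_fam p q Fam = #|restr Fam AB.1 AB.2|.
  rewrite /beta_fam; elim/big_ind: _ => [|x y Kx Ky|AB adm]; first by left.
    by rewrite /minn; case: ifP.
  by right; exists AB.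
case=> // eqF; exists AB0 => //; apply/eqP.
rewrite eqn_leq lb //= eqF; apply: subset_leq_card.
by apply/subsetP=> F; rewrite inE => /andP[].
Qed.

(* Main.v *)
Require Import Defs.
From mathcomp Require Import all_boot all_order all_algebra.
From mathcomp Require Import zify.
Set Implicit Arguments.
Unset Strict Implicit.
Unset Printing Implicit Defensive.
Import GRing.Theory.

(** The lower bounds come from the k-sets containing an edge of a triangle
    (q = 1), respectively a line of the Fano plane (q = 2).

    For the upper bounds enlarge the family to a maximal intersecting one, M.
    Its blocking sets of size at most k then pairwise meet.  Branching on the
    members of M yields boundedly many sets, each of size q + 2 or blocking of
    size at most q + 1, such that every member of M contains one of them; so if
    A avoids all of them, the sets of size q + 2 contribute a lower order term.
    For q = 1 either one point lies in all the blocking sets of size at most 2,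
    or two of them force two points outside a suitable B.
    For q = 2 either some pair B is avoided by at most one blocking set of size
    at most 3 (which has size 3), and the count is about half of the claimed
    value, or the blocking 3-sets form an intersecting family in which every
    pair is avoided by two edges.  Such a family looks like the Fano plane or
    the 2-(6,3,2) design, and some pair B forces every blocking set off B to
    contain one of two intersecting triples, so that inclusion-exclusion gives
    the exact bound. *)

(** * Intersecting triple systems and their transversals *)

Lemma count_mem_card (T : finType) (A : {set T}) (s : seq T) :
  uniq s -> count (mem A) s <= #|A|.
Proof.
move=> us; rewrite -size_filter -(card_uniqP (filter_uniq _ us)).
by apply: subset_leq_card; apply/subsetP=> x; rewrite mem_filter => /andP[].
Qed.

Lemma card_set_seq (T : finType) (s : seq T) : uniq s -> #|[set x in s]| = size s.
Proof. by move=> us; rewrite cardsE; apply/card_uniqP. Qed.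

Lemma set3_seq (T : finType) (x y z : T) : [set x; y; z] = [set t in [:: x; y; z]].
Proof. by apply/setP=> t; rewrite !inE !orbA. Qed.

Lemma meet_set3 (T : finType) (e : {set T}) x y z :
  [set x; y; z] :&: e != set0 -> [|| x \in e, y \in e | z \in e].
Proof.
by case/set0Pn=> t; rewrite !inE => /andP[/orP[/orP[]|] /eqP-> ->]; rewrite ?orbT.
Qed.

(** The structure left for q = 2 when no pair B is avoided by at most one small blocking set. *)
Definition robust_clique (T : finType) (H : {set {set T}}) : Prop :=
  [/\ forall e, e \in H -> #|e| = 3,
      forall e f, e \in H -> f \in H -> e :&: f != set0 &
      forall x y, x != y -> exists e f,
        [/\ e \in H, f \in H, e != f, (x \notin e) && (y \notin e)
          & (x \notin f) && (y \notin f)]].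

(** The input of the inclusion-exclusion count off B. The common point of [L1] and [L2] keeps their
    union within five points. *)
Definition two_edge_trace (T : finType) (H : {set {set T}}) : Prop :=
  exists B L1 L2 : {set T},
    [/\ #|B| = 2, #|L1| = 3 /\ #|L2| = 3, L1 != L2, L1 :&: L2 != set0 &
        [/\ B :&: L1 = set0, B :&: L2 = set0 &
      forall F : {set T}, (forall e, e \in H -> e :&: F != set0) ->
        B :&: F = set0 -> L1 \subset F \/ L2 \subset F]].

Section RobustClique.
Context (T : finType) (H : {set {set T}}) (RH : robust_clique H).
Implicit Types (e : {set T}) (x y z : T).

(** Two edges avoid the pair, so excluding [g] leaves one; [g := set0] just asks for an edge. *)
Lemma other_edge g x y : x != y ->
  exists e, [/\ e \in H, e != g, x \notin e & y \notin e].
Proof.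
case: RH => _ _ P xy; have [e [f [eH fH ef /andP[xe ye] /andP[xf yf]]]] := P _ _ xy.
case: (eqVneq e g) => [eg|neg]; last by exists e.
by exists f; rewrite -eg eq_sym ef.
Qed.

Lemma edge_meet x y z e : [set x; y; z] \in H -> e \in H ->
  [|| x \in e, y \in e | z \in e].
Proof. by case: RH => _ HI _ h eH; apply: meet_set3; apply: HI. Qed.

Lemma edge_eq e x y z : e \in H -> uniq [:: x; y; z] ->
  [&& x \in e, y \in e & z \in e] -> e = [set x; y; z].
Proof.
case: RH => H3 _ _ eH u /and3P[xe ye ze]; apply/esym/eqP.
rewrite eqEcard H3 // set3_seq (card_set_seq u) -set3_seq.
by rewrite !subUset !sub1set xe ye ze.
Qed.

Lemma edge_in e x y z : e \in H -> uniq [:: x; y; z] ->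
  [&& x \in e, y \in e & z \in e] -> [set x; y; z] \in H.
Proof. by move=> eH u xyz; rewrite -(edge_eq eH u xyz). Qed.

Lemma edge_neq e x y z : e \in H -> uniq [:: x; y; z] -> e != [set x; y; z] ->
  ~~ [&& x \in e, y \in e & z \in e].
Proof. by move=> eH u; apply: contra => /(edge_eq eH u)->. Qed.

Lemma edge_count e s : e \in H -> uniq s -> count (mem e) s <= 3.
Proof. by case: RH => H3 _ _ eH /(count_mem_card e); rewrite H3. Qed.

Lemma edge_swap x y z : [set x; y; z] \in H -> [set x; z; y] \in H.
Proof. by rewrite setUAC. Qed.

End RobustClique.

Ltac distinct :=
  rewrite /= ?inE ?negb_or ?andbT;
  repeat (apply/andP; split); first [assumption | rewrite eq_sym; assumption].

Ltac distinct_in U :=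
  move: U; rewrite /= ?inE ?negb_or ?andbT;
  let rec go := (first [case/andP; go; go | move=> ?]) in go;
  distinct.

(** Once the meeting conditions are in the goal, a claim about an edge is a Boolean tautology in the
    memberships of the named points. *)
Ltac membership_cases := repeat match goal with
  | |- context [?x \in ?e] => case: (x \in e) end.

(** The triples share [a]; [x] may coincide with [u] or [v], as happens for the six-point design. *)
Lemma two_edge_traceI (T : finType) (H : {set {set T}}) p q a u v x y :
  p != q -> uniq [:: a; u; v] -> uniq [:: a; x; y] ->
  [&& p != a, p != u, p != v, p != x & p != y] ->
  [&& q != a, q != u, q != v, q != x & q != y] ->
  (y != u) && (y != v) ->
  (forall F : {set T}, (forall e, e \in H -> e :&: F != set0) ->
    p \notin F -> q \notin F ->
    [&& a \in F, u \in F & v \in F] || [&& a \in F, x \in F & y \in F]) ->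
  two_edge_trace H.
Proof.
move=> pq U1 U2 /and5P[pa pu pv px py] /and5P[qa qu qv qx qy] /andP[yu yv] HF.
have ya : y != a by distinct_in U2.
have disj z t (L : {set T}) : z \notin L -> t \notin L -> [set z; t] :&: L = set0.
  move=> zL tL; apply/setP=> s; rewrite !inE.
  by case: eqVneq => [->|_]; [rewrite (negPf zL) | case: eqVneq => // ->; rewrite (negPf tL)].
exists [set p; q], [set a; u; v], [set a; x; y]; split.
- by rewrite cards2 pq.
- by rewrite !set3_seq !card_set_seq.
- apply/eqP=> /setP/(_ y); rewrite !inE eqxx orbT.
  by rewrite (negPf ya) (negPf yu) (negPf yv).
- by apply/set0Pn; exists a; rewrite !inE eqxx.
split.
- by apply: disj; rewrite !inE !negb_or ?pa ?pu ?pv ?qa ?qu ?qv.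
- by apply: disj; rewrite !inE !negb_or ?pa ?px ?py ?qa ?qx ?qy.
move=> F FH /setP FB; rewrite !subUset !sub1set -!andbA.
apply/orP; apply: HF => //.
  by move: (FB p); rewrite !inE eqxx /= => ->.
by move: (FB q); rewrite !inE eqxx orbT /= => ->.
Qed.

(** The avoided pairs force [cuw] and [abw] to be edges. A transversal off [a] and [b] then contains
    [c] and [w], and also [u] or [v] because of [auv]. *)
Lemma cherry_trace_aux (T : finType) (H : {set {set T}}) a b c u v w :
  robust_clique H -> uniq [:: a; b; c; u; v; w] ->
  [set a; b; c] \in H -> [set a; u; v] \in H -> [set a; u; w] \in H ->
  [set b; v; w] \in H -> [set c; v; w] \in H -> [set b; u; v] \in H ->
  two_edge_trace H.
Proof.
move=> RH U abc auv auw bvw cvw buv.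
have ab : a != b by distinct_in U.
have uv : u != v by distinct_in U.
have Uabc : uniq [:: a; b; c] by distinct_in U.
have Ucvw : uniq [:: c; v; w] by distinct_in U.
have Ucuv : uniq [:: c; u; v] by distinct_in U.
have Ucuw : uniq [:: c; u; w] by distinct_in U.
have Uabw : uniq [:: a; b; w] by distinct_in U.
have cuvN : [set c; u; v] \notin H.
  apply/negP=> cuv.
  (* Off [u] and [v], meeting [auv], [buv] and [cuv] would force the excluded edge [abc]. *)
  have [e [eH eN ue ve]] := other_edge RH [set a; b; c] uv.
  move: (edge_neq RH eH Uabc eN) (edge_meet RH auv eH) (edge_meet RH buv eH).
  by move: (edge_meet RH cuv eH) ue ve; membership_cases.
have cuw : [set c; u; w] \in H.
  have [e [eH eN ae be]] := other_edge RH [set c; v; w] ab.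
  have : [&& c \in e, u \in e & v \in e] || [&& c \in e, u \in e & w \in e].
    move: (edge_neq RH eH Ucvw eN) (edge_meet RH abc eH) (edge_meet RH auv eH).
    move: (edge_meet RH auw eH) (edge_meet RH bvw eH) ae be.
    by membership_cases.
  case/orP=> [/(edge_in RH eH Ucuv) cuv | /(edge_in RH eH Ucuw)//].
  by rewrite cuv in cuvN.
have abw : [set a; b; w] \in H.
  have [e [eH eN ue ve]] := other_edge RH [set a; b; c] uv.
  apply: (edge_in RH eH) => //.
  move: (edge_neq RH eH Uabc eN) (edge_meet RH auv eH) (edge_meet RH buv eH).
  by move: (edge_meet RH cuw eH) ue ve; membership_cases.
apply: (@two_edge_traceI _ H a b c w u w v); try by distinct_in U.
move=> F HF aF bF.
move: (meet_set3 (HF _ abc)) (meet_set3 (HF _ abw)) (meet_set3 (HF _ auv)) aF bF.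
by membership_cases.
Qed.

(* The configuration here is the 2-(6,3,2) design. *)
Lemma cherry_trace (T : finType) (H : {set {set T}}) a b c u v w :
  robust_clique H -> uniq [:: a; b; c; u; v; w] ->
  [set a; b; c] \in H -> [set a; u; v] \in H -> [set a; u; w] \in H ->
  two_edge_trace H.
Proof.
move=> RH U abc auv auw.
have ua : u != a by distinct_in U.
have ac : a != c by distinct_in U.
have Ubvw : uniq [:: b; v; w] by distinct_in U.
have Ucvw : uniq [:: c; v; w] by distinct_in U.
have Ubuv : uniq [:: b; u; v] by distinct_in U.
have Ubuw : uniq [:: b; u; w] by distinct_in U.
(* Without [u] and [a], meeting [auv] and [auw] requires both [v] and [w]. Two edges avoid the pair,
   so both candidates occur. *)
have bvw_or_cvw e : e \in H -> u \notin e -> a \notin e ->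
    e = [set b; v; w] \/ e = [set c; v; w].
  move=> eH ue ae.
  have : [&& b \in e, v \in e & w \in e] || [&& c \in e, v \in e & w \in e].
    move: (edge_meet RH abc eH) (edge_meet RH auv eH) (edge_meet RH auw eH) ue ae.
    by membership_cases.
  case/orP=> /(edge_eq RH eH) h; by [left; apply: h | right; apply: h].
have [bvw cvw] : [set b; v; w] \in H /\ [set c; v; w] \in H.
  case: (RH) => _ _ P.
  have [e [f [eH fH ef /andP[ue ae] /andP[uf af]]]] := P _ _ ua.
  move: (eH) (fH) ef.
  case: (bvw_or_cvw _ eH ue ae) => ->; case: (bvw_or_cvw _ fH uf af) => -> //;
    by rewrite eqxx.
have [e [eH eN ae ce]] := other_edge RH [set b; v; w] ac.
have : [&& b \in e, u \in e & v \in e] || [&& b \in e, u \in e & w \in e].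
  move: (edge_neq RH eH Ubvw eN) (edge_meet RH abc eH) (edge_meet RH auv eH).
  move: (edge_meet RH auw eH) (edge_meet RH cvw eH) ae ce.
  by membership_cases.
(* The two outcomes are exchanged by swapping [v] and [w]. *)
case/orP=> [/(edge_in RH eH Ubuv) buv | /(edge_in RH eH Ubuw) buw].
  exact: (cherry_trace_aux RH U abc auv auw bvw cvw buv).
apply: (@cherry_trace_aux _ H a b c u w v RH) => //; first by distinct_in U.
  exact: edge_swap.
exact: edge_swap.
Qed.

(** An edge off [a] and [b] is [cux] or [cuy], so both are edges; an edge off [u] and [a] would then
    need four of the seven points. *)
Lemma double_cherry_contra (T : finType) (H : {set {set T}}) a b c u v x y :
  robust_clique H -> uniq [:: a; b; c; u; v; x; y] ->
  [set a; b; c] \in H -> [set a; u; v] \in H -> [set a; x; y] \in H ->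
  [set b; u; x] \in H -> [set b; u; y] \in H -> False.
Proof.
move=> RH U abc auv axy bux buy.
have ab : a != b by distinct_in U.
have ua : u != a by distinct_in U.
have Ucux : uniq [:: c; u; x] by distinct_in U.
have Ucuy : uniq [:: c; u; y] by distinct_in U.
have cux_or_cuy e : e \in H -> a \notin e -> b \notin e ->
    e = [set c; u; x] \/ e = [set c; u; y].
  move=> eH ae be.
  have : [&& c \in e, u \in e & x \in e] || [&& c \in e, u \in e & y \in e].
    move: (edge_meet RH abc eH) (edge_meet RH auv eH) (edge_meet RH axy eH) ae be.
    move: (edge_meet RH bux eH) (edge_meet RH buy eH) (edge_count RH eH U) => /=.
    by membership_cases.
  case/orP=> /(edge_eq RH eH) h; by [left; apply: h | right; apply: h].
have [cux cuy] : [set c; u; x] \in H /\ [set c; u; y] \in H.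
  case: (RH) => _ _ P.
  have [e [f [eH fH ef /andP[ae be] /andP[af bf]]]] := P _ _ ab.
  move: (eH) (fH) ef.
  case: (cux_or_cuy _ eH ae be) => ->; case: (cux_or_cuy _ fH af bf) => -> //;
    by rewrite eqxx.
have [e [eH _ ue ae]] := other_edge RH set0 ua.
move: (edge_meet RH abc eH) (edge_meet RH auv eH) (edge_meet RH axy eH) ue ae.
move: (edge_meet RH bux eH) (edge_meet RH buy eH) (edge_count RH eH U) => /=.
move: (edge_meet RH cux eH) (edge_meet RH cuy eH).
by membership_cases.
Qed.

(* The configuration here is the Fano plane. *)
Lemma quadrangle_trace (T : finType) (H : {set {set T}}) a b c u v x y :
  robust_clique H -> uniq [:: a; b; c; u; v; x; y] ->
  [set a; b; c] \in H -> [set a; u; v] \in H -> [set a; x; y] \in H ->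
  [set b; u; x] \in H -> [set b; v; y] \in H -> two_edge_trace H.
Proof.
move=> RH U abc auv axy bux bvy.
have ab : a != b by distinct_in U.
have Ucuy : uniq [:: c; u; y] by distinct_in U.
have Ucvx : uniq [:: c; v; x] by distinct_in U.
(* Besides [c], only two points remain to meet four edges, which leaves the two missing lines. *)
have cuy_or_cvx e : e \in H -> a \notin e -> b \notin e ->
    e = [set c; u; y] \/ e = [set c; v; x].
  move=> eH ae be.
  have : [&& c \in e, u \in e & y \in e] || [&& c \in e, v \in e & x \in e].
    move: (edge_meet RH abc eH) (edge_meet RH auv eH) (edge_meet RH axy eH) ae be.
    move: (edge_meet RH bux eH) (edge_meet RH bvy eH) (edge_count RH eH U) => /=.
    by membership_cases.
  case/orP=> /(edge_eq RH eH) h; by [left; apply: h | right; apply: h].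
have [cuy cvx] : [set c; u; y] \in H /\ [set c; v; x] \in H.
  case: (RH) => _ _ P.
  have [e [f [eH fH ef /andP[ae be] /andP[af bf]]]] := P _ _ ab.
  move: (eH) (fH) ef.
  case: (cuy_or_cvx _ eH ae be) => ->; case: (cuy_or_cvx _ fH af bf) => -> //;
    by rewrite eqxx.
apply: (@two_edge_traceI _ H b c a u v x y); try by distinct_in U.
move=> F HF bF cF.
move: (meet_set3 (HF _ abc)) (meet_set3 (HF _ bux)) (meet_set3 (HF _ bvy)) bF cF.
move: (meet_set3 (HF _ cuy)) (meet_set3 (HF _ cvx)).
by membership_cases.
Qed.

(** An edge off [a] and [c] consists of [b], one of [u], [v] and one of [x], [y]. Two of them either
    share a second point, which is impossible, or are opposite and lead to the Fano plane. *)
Lemma sunflower_trace (T : finType) (H : {set {set T}}) a b c u v x y :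
  robust_clique H -> uniq [:: a; b; c; u; v; x; y] ->
  [set a; b; c] \in H -> [set a; u; v] \in H -> [set a; x; y] \in H ->
  two_edge_trace H.
Proof.
move=> RH U abc auv axy.
have ac : a != c by distinct_in U.
have avu := edge_swap auv; have ayx := edge_swap axy.
have Ub : [/\ uniq [:: b; u; x], uniq [:: b; u; y], uniq [:: b; v; x]
            & uniq [:: b; v; y]] by split; distinct_in U.
case: Ub => Ubux Ubuy Ubvx Ubvy.
have pick_b e : e \in H -> a \notin e -> c \notin e ->
    [\/ e = [set b; u; x], e = [set b; u; y], e = [set b; v; x] | e = [set b; v; y]].
  move=> eH ae ce.
  have : [|| [&& b \in e, u \in e & x \in e], [&& b \in e, u \in e & y \in e],
             [&& b \in e, v \in e & x \in e] | [&& b \in e, v \in e & y \in e]].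
    move: (edge_meet RH abc eH) (edge_meet RH auv eH) (edge_meet RH axy eH) ae ce.
    by membership_cases.
  by case/or4P=> /(edge_eq RH eH) h; [constructor 1|constructor 2|constructor 3
    |constructor 4]; apply: h.
(* Relabellings that bring every pair of candidates to one of the two preceding configurations. *)
have Uvu : uniq [:: a; b; c; v; u; x; y] by distinct_in U.
have Uyx : uniq [:: a; b; c; u; v; y; x] by distinct_in U.
have Uxu : uniq [:: a; b; c; x; y; u; v] by distinct_in U.
have Uyu : uniq [:: a; b; c; y; x; u; v] by distinct_in U.
have ux_uy := double_cherry_contra RH U abc auv axy.
have vx_vy := double_cherry_contra RH Uvu abc avu axy.
have ux_vx h h' :=
  double_cherry_contra RH Uxu abc axy auv (edge_swap h) (edge_swap h').
have uy_vy h h' :=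
  double_cherry_contra RH Uyu abc ayx auv (edge_swap h) (edge_swap h').
have ux_vy := quadrangle_trace RH U abc auv axy.
have uy_vx := quadrangle_trace RH Uyx abc auv ayx.
case: (RH) => _ _ P.
have [e [f [eH fH ef /andP[ae ce] /andP[af cf]]]] := P _ _ ac.
move: (eH) (fH) ef.
case: (pick_b _ eH ae ce) => ->; case: (pick_b _ fH af cf) => -> h1 h2;
  rewrite ?eqxx // => _; solve [exact: ux_vy | exact: uy_vx
   | by [case: (ux_uy h1 h2) | case: (ux_uy h2 h1) | case: (vx_vy h1 h2)
        | case: (vx_vy h2 h1) | case: (ux_vx h1 h2) | case: (ux_vx h2 h1)
        | case: (uy_vy h1 h2) | case: (uy_vy h2 h1)]].
Qed.

Lemma set3_of_mem (T : finType) (e : {set T}) x :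
  #|e| = 3 -> x \in e -> exists y z, uniq [:: x; y; z] /\ e = [set x; y; z].
Proof.
move=> e3 xe; have /cards2P[y [z [yz Eyz]]] : #|e :\ x| == 2.
  by rewrite -eqSS -e3 (cardsD1 x e) xe.
have : (y \in e :\ x) && (z \in e :\ x) by rewrite Eyz !inE !eqxx orbT.
rewrite !inE => /andP[/andP[yx ye] /andP[zx ze]]; exists y, z.
have U : uniq [:: x; y; z] by rewrite /= !inE !negb_or eq_sym yx eq_sym zx yz.
split=> //; apply/esym/eqP.
by rewrite eqEcard e3 set3_seq (card_set_seq U) -set3_seq !subUset !sub1set xe ye ze.
Qed.

(** Fix an edge [abc]. Two edges off [b] and [c] must pass through [a]; they share a second point
    (cherry) or not (sunflower). *)
Lemma robust_clique_trace (T : finType) (H : {set {set T}}) :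
  robust_clique H -> 1 < #|T| -> two_edge_trace H.
Proof.
move=> RH; rewrite -cardsT => /card_gt1P[p [q [_ _ pq]]].
have [L [LH _ _ _]] := other_edge RH set0 pq.
case: (RH) => H3 _ P; have L3 := H3 _ LH.
have /card_gt0P[a aL] : 0 < #|L| by rewrite L3.
have [b [c [Uabc LE]]] := set3_of_mem L3 aL; rewrite LE in LH.
have bc : b != c by distinct_in Uabc.
have thru e : e \in H -> b \notin e -> c \notin e ->
    exists x y, uniq [:: a; x; y] /\ e = [set a; x; y].
  move=> eH be ce; apply: set3_of_mem; first exact: H3.
  by move: (edge_meet RH LH eH); rewrite (negPf be) (negPf ce) !orbF.
have [e [f [eH fH ef /andP[be ce] /andP[bf cf]]]] := P _ _ bc.
have [u [v [Uauv Ee]]] := thru e eH be ce.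
have [x [y [Uaxy Ef]]] := thru f fH bf cf.
rewrite {e}Ee in eH be ce ef; rewrite {f}Ef in fH bf cf ef.
move: be ce bf cf; rewrite !inE !negb_or -!andbA.
case/and3P=> ba bu bv /and3P[ca cu cv] /and3P[_ bx b_y] /and3P[_ cx cy].
have [ab ac] : a != b /\ a != c by split; distinct_in Uabc.
move: Uauv Uaxy; rewrite /= !inE !negb_or !andbT -!andbA.
case/and3P=> au av uv /and3P[ax ay xy].
have cherry s t t' : [set a; s; t] \in H -> [set a; s; t'] \in H ->
    [set a; s; t] != [set a; s; t'] -> uniq [:: a; b; c; s; t] ->
    uniq [:: a; b; c; s; t'] -> two_edge_trace H.
  move=> h h' neq U U'; apply: (@cherry_trace _ H a b c s t t' RH) => //.
  have tt : t != t' by apply: contra neq => /eqP->.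
  rewrite -[[:: a; b; c; s; t; t']]/(rcons [:: a; b; c; s; t] t') rcons_uniq U andbT.
  move: U'; rewrite -[[:: a; b; c; s; t']]/(rcons [:: a; b; c; s] t') rcons_uniq.
  by case/andP; rewrite !inE !negb_or => /and4P[-> -> -> ->] _; rewrite eq_sym tt.
have eH' := edge_swap eH; have fH' := edge_swap fH.
have Uu : uniq [:: a; b; c; u; v] by distinct.
have Uv : uniq [:: a; b; c; v; u] by distinct.
have Ux : uniq [:: a; b; c; x; y] by distinct.
have Uy : uniq [:: a; b; c; y; x] by distinct.
case: (eqVneq u x) => [Eux|ux].
  by move: fH ef Ux; rewrite -Eux => fH ef Ux; apply: cherry eH fH ef Uu Ux.
case: (eqVneq v x) => [Evx|vx].
  move: fH ef Ux; rewrite -Evx (setUAC _ [set u]) => fH ef Ux.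
  exact: cherry eH' fH ef Uv Ux.
case: (eqVneq u y) => [Euy|uy].
  move: fH' ef Uy; rewrite -Euy (setUAC _ [set x]) => fH' ef Uy.
  exact: cherry eH fH' ef Uu Uy.
case: (eqVneq v y) => [Evy|vy].
  move: fH' ef Uy; rewrite -Evy (setUAC _ [set x]) (setUAC _ [set u]) => fH' ef Uy.
  exact: cherry eH' fH' ef Uv Uy.
by apply: (@sunflower_trace _ H a b c u v x y RH) => //; distinct.
Qed.

(** * Counting k-sets with prescribed and forbidden points *)

Definition upset n k (A B : {set 'I_n}) : {set {set 'I_n}} :=
  [set F : {set 'I_n} | [&& #|F| == k, A \subset F & B :&: F == set0]].

(* The number of k-subsets of [n] containing a given s-set and avoiding a given
   q-set disjoint from it. *)
Definition cnt (n k q s : nat) : nat := if s <= k then 'C(n - s - q, k - s) else 0.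

Lemma card_upset n k (A B : {set 'I_n}) : A :&: B = set0 ->
  #|upset k A B| = cnt n k #|B| #|A|.
Proof.
move=> AB; rewrite /cnt; case: leqP => [leAk|ltkA]; last first.
  apply: eq_card0 => F; rewrite !inE; apply/negP=> /and3P[/eqP Fk AF _].
  by have := subset_leq_card AF; lia.
have ABC : #|~: (A :|: B)| = n - #|A| - #|B|.
  by rewrite cardsCs setCK cardsU AB cards0 subn0 card_ord subnDA.
rewrite -ABC -cards_draws.
have inj : {in [set X : {set 'I_n} | X \subset ~: (A :|: B) & #|X| == k - #|A|] &,
    injective (fun X => A :|: X)}.
  move=> X Y; rewrite !inE => /andP[X1 _] /andP[Y1 _] E.
  have h (Z : {set 'I_n}) : Z \subset ~: (A :|: B) -> Z = (A :|: Z) :\: A.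
    move=> Zs; rewrite setDUl setDv set0U; apply/esym/setDidPl.
    by rewrite disjoints_subset (subset_trans Zs) // setCS subsetUl.
  by rewrite (h X) // (h Y) // E.
rewrite -(card_in_imset inj); apply: eq_card => F.
apply/idP/imsetP => [|[X]]; rewrite !inE.
  case/and3P=> /eqP Fk AF BF; exists (F :\: A); last first.
    by rewrite setDE setUIr setUCr setIT; apply/esym/setUidPr.
  rewrite inE setCU cardsD (setIidPr AF) Fk eqxx andbT.
  rewrite subsetI -!disjoints_subset; apply/andP; split.
    by rewrite -setI_eq0 setIDAC setDIl setDv setI0.
  by apply: disjointWl (subsetDl _ _) _; rewrite disjoint_sym -setI_eq0.
case/andP=> Xs /eqP Xk ->; move: Xs; rewrite setCU subsetI -!disjoints_subset -!setI_eq0.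
case/andP=> /eqP XA /eqP XB.
by rewrite cardsU setIC XA cards0 subn0 Xk subnKC // eqxx subsetUl setIUr setIC AB set0U setIC XB eqxx.
Qed.

Lemma card_upset_leq n k (A B : {set 'I_n}) : #|upset k A B| <= cnt n k #|B| #|A|.
Proof.
case: (eqVneq (A :&: B) set0) => [/card_upset->//|AB].
rewrite eq_card0 // => F; rewrite !inE; apply: contra_neqF AB => /and3P[_ AF /eqP BF].
by apply/eqP; rewrite -subset0 -BF setIC setIS.
Qed.

(** One more required point costs a factor (k-s)/(n-s-q), at most 1/K here. This makes the larger
    basis sets negligible. *)
Lemma cnt_step n k q s K : K * k + s + q < n -> K * cnt n k q s.+1 <= cnt n k q s.
Proof.
move=> h; rewrite /cnt; case: (ltngtP s k) => [lt_sk|lt|eq_sk]; rewrite ?muln0 //.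
have -> : n - s - q = (n - s.+1 - q).+1 by lia.
have -> : k - s = (k - s.+1).+1 by lia.
set m := n - s.+1 - q; set l := k - s.+1.
have hm : K * l.+1 <= m.+1.
  have : K * l.+1 <= K * k by rewrite leq_mul2l /l subnSK // leq_subr orbT.
  by rewrite /m; lia.
have /= := mul_bin_diag m.+1 l; rewrite -(@leq_pmul2l m.+1) //.
set u := 'C(_, _); set v := 'C(_, _) => E.
rewrite mulnCA; apply: leq_trans (_ : l.+1 * v * K <= _); first by rewrite -E mulnC.
by rewrite mulnAC leq_mul2r [l.+1 * K]mulnC hm orbT.
Qed.

Lemma leq_cnt n k q s t : k + t + q <= n -> s <= t -> cnt n k q t <= cnt n k q s.
Proof.
move=> h; elim: t h => [|t IH] h; first by rewrite leqn0 => /eqP->.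
rewrite leq_eqVlt => /orP[/eqP->//|/IH le]; apply: leq_trans (le _); last by lia.
by rewrite -[cnt _ _ _ t.+1]mul1n cnt_step; lia.
Qed.

Lemma card_bigcup_leq (I T : finType) (P : {set I}) (F : I -> {set T}) m :
  (forall i, i \in P -> #|F i| <= m) -> #|\bigcup_(i in P) F i| <= #|P| * m.
Proof.
move=> h; rewrite -sum_nat_const.
elim/big_ind2: _ => [|X a Y b Xa Yb|i iP]; first by rewrite cards0.
  by apply: leq_trans (leq_card_setU _ _) _; apply: leq_add.
exact: h.
Qed.

Lemma card_covered_leq n k (G : {set {set 'I_n}}) (TT : {set {set 'I_n}}) A B s :
  (forall F, F \in G -> exists2 T, T \in TT & F \in upset k (A :|: T) B) ->
  (forall T, T \in TT -> #|A :|: T| = s) ->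
  #|G| <= #|TT| * cnt n k #|B| s.
Proof.
move=> hG hT.
apply: leq_trans (_ : #|\bigcup_(T in TT) upset k (A :|: T) B| <= _).
  apply: subset_leq_card; apply/subsetP=> F /hG[T TTT FT].
  by apply/bigcupP; exists T.
by apply: card_bigcup_leq => T /hT <-; apply: card_upset_leq.
Qed.

(** * Blocking sets, branching and maximal intersecting families *)

Definition blocking n (Fam : {set {set 'I_n}}) (T : {set 'I_n}) : bool :=
  [forall F in Fam, T :&: F != set0].

Lemma blockingP n (Fam : {set {set 'I_n}}) (T F : {set 'I_n}) :
  blocking Fam T -> F \in Fam -> T :&: F != set0.
Proof. by move/forall_inP; apply. Qed.

Lemma uniformP n k (Fam : {set {set 'I_n}}) F : uniform k Fam -> F \in Fam -> #|F| = k.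
Proof. by move/forall_inP=> h /h/eqP. Qed.

(** If some member misses T, every member containing T meets that one, hence contains T with one of
    its k points added. Repeat d times from the empty set, stopping at blocking sets. *)
Lemma branching_basis n k (Fam : {set {set 'I_n}}) d :
  uniform k Fam -> intersecting Fam -> 0 < k ->
  exists TT : {set {set 'I_n}},
    [/\ #|TT| <= k ^ d, forall F, F \in Fam -> exists2 T, T \in TT & T \subset F &
        forall T, T \in TT -> #|T| = d \/ #|T| < d /\ blocking Fam T].
Proof.
move=> UF IF k0; elim: d => [|d [TT [TTk TTF TTT]]].
  exists [set set0]; split; first by rewrite cards1.
    by move=> F _; exists set0; rewrite ?inE ?sub0set.
  by move=> T; rewrite inE => /eqP->; left; rewrite cards0.
(* The default is harmless: [g] uses [miss T] only when T is not blocking. *)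
pose miss T := odflt set0 [pick F in Fam | T :&: F == set0].
pose g T := if blocking Fam T then [set T] else [set y |: T | y in miss T].
have missP T : ~~ blocking Fam T -> miss T \in Fam /\ T :&: miss T = set0.
  rewrite /miss negb_forall => /existsP[F]; rewrite negb_imply negbK => /andP[FF TF].
  by case: pickP => [F' /andP[? /eqP]//|/(_ F)]; rewrite FF TF.
exists (\bigcup_(T in TT) g T); split.
- have gk T : T \in TT -> #|g T| <= k.
    move=> TTt; rewrite /g; case: ifPn => [_|/missP[mF _]]; first by rewrite cards1.
    by apply: leq_trans (leq_imset_card _ _) _; rewrite (uniformP UF mF).
  by apply: leq_trans (card_bigcup_leq gk) _; rewrite expnSr leq_mul.
- move=> F FF; have [T TTt TF] := TTF _ FF.
  case tT: (blocking Fam T).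
    by exists T => //; apply/bigcupP; exists T => //; rewrite /g tT inE.
  have [mF _] := missP _ (negbT tT).
  have /set0Pn[y] : miss T :&: F != set0.
    by move/forall_inP: IF => /(_ _ mF)/forall_inP/(_ _ FF).
  rewrite inE => /andP[ym yF]; exists (y |: T); last by rewrite subUset sub1set yF.
  apply/bigcupP; exists T => //; rewrite /g tT; exact: imset_f.
- move=> T' /bigcupP[T TTt]; rewrite /g; case: ifPn => [tT|/[dup] nT /missP[mF Tm]].
    by rewrite inE => /eqP->; right; split=> //; case: (TTT _ TTt) => [->//|[]]; lia.
  case/imsetP=> y ym ->; left.
  have yT : y \notin T.
    by apply/negP=> yT; move/setP/(_ y): Tm; rewrite !inE yT ym.
  by rewrite cardsU1 yT; case: (TTT _ TTt) => [->//|[_]]; rewrite (negPf nT).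
Qed.

Lemma maximal_extension n k (Fam : {set {set 'I_n}}) :
  uniform k Fam -> intersecting Fam ->
  exists M : {set {set 'I_n}}, [/\ uniform k M, intersecting M, Fam \subset M &
    forall G : {set 'I_n}, #|G| = k -> 0 < k -> blocking M G -> G \in M].
Proof.
move=> UF IF; pose P (G : {set {set 'I_n}}) := uniform k G && intersecting G.
have /maxset_exists[M /maxsetP[/andP[UM IM] maxM] FM] : P Fam by rewrite /P UF IF.
exists M; split=> // G Gk k0 tG.
rewrite -(maxM (G |: M)) ?setU11 ?subsetUr //; apply/andP; split.
  apply/forall_inP=> F; rewrite !inE => /orP[/eqP->|/(uniformP UM)->]; by rewrite ?Gk.
apply/forall_inP=> F FG; apply/forall_inP=> F' FG'; move: FG FG'; rewrite !inE.
case/orP=> [/eqP->|FM'] /orP[/eqP->|FM''].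
(* [0 < k] matters here: the added set must meet itself. *)
- by rewrite setIid -card_gt0 Gk.
- exact: blockingP tG _.
- by rewrite setIC; apply: blockingP tG _.
- by move/forall_inP: IM => /(_ _ FM')/forall_inP/(_ _ FM'').
Qed.

Lemma subset_of_card (T : finType) (D : {set T}) m :
  m <= #|D| -> exists2 A : {set T}, A \subset D & #|A| = m.
Proof.
move=> le_m; have : 0 < #|[set A : {set T} | A \subset D & #|A| == m]|.
  by rewrite cards_draws bin_gt0.
by case/card_gt0P=> A; rewrite inE => /andP[sA /eqP cA]; exists A.
Qed.

Lemma superset_of_card (T : finType) (S D : {set T}) m :
  S \subset D -> #|S| <= m <= #|D| ->
  exists A : {set T}, [/\ S \subset A, A \subset D & #|A| = m].
Proof.
move=> SD /andP[Sm mD].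
have [|X XD Xm] := @subset_of_card _ (D :\: S) (m - #|S|).
  by rewrite cardsD (setIidPr SD); lia.
exists (S :|: X); rewrite subsetUl subUset SD (subset_trans XD (subsetDl _ _)).
have XS : S :&: X = set0.
  by apply/eqP; rewrite setIC setI_eq0 disjoints_subset (subset_trans XD) // setDE subsetIr.
by rewrite cardsU XS cards0 Xm; split=> //; lia.
Qed.

(** If S and T were disjoint, S would extend within the complement of T to a k-set. That set is
    still blocking, so it lies in M by maximality, yet T misses it. *)
Lemma blocking_sets_meet n k (M : {set {set 'I_n}}) (S T : {set 'I_n}) :
  (forall G : {set 'I_n}, #|G| = k -> 0 < k -> blocking M G -> G \in M) ->
  0 < k -> k + k <= n -> blocking M S -> blocking M T ->
  #|S| <= k -> #|T| <= k -> S :&: T != set0.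
Proof.
move=> maxM k0 kn tS tT Sk Tk; apply/negP=> ST.
have [||G [SG GT Gk]] := @superset_of_card _ S (~: T) k.
- by rewrite -disjoints_subset -setI_eq0.
- by rewrite Sk cardsCs setCK card_ord; lia.
have GM : G \in M.
  apply: maxM => //; apply/forall_inP=> F FM; apply: contra (blockingP tS FM).
  by rewrite -!subset0; apply: subset_trans; apply: setSI.
by have := blockingP tT GM; rewrite setIC setI_eq0 disjoints_subset GT.
Qed.

(** There is room for a generic A off B, S and the whole basis, so a basis set of size t demands t
    new points. *)
Lemma beta_fam_leq_restr n p q d N (Fam M TT : {set {set 'I_n}}) (B S : {set 'I_n}) :
  Fam \subset M -> #|TT| <= N -> (forall T, T \in TT -> #|T| <= d) ->
  #|B| = q -> p + q + N * d + #|S| <= n ->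
  exists A : {set 'I_n}, [/\ #|A| = p, A :&: B = set0, A :&: S = set0,
    forall T, T \in TT -> A :&: T = set0 & beta_fam p q Fam <= #|restr M A B|].
Proof.
move=> FM TTN TTd Bq large.
pose U := \bigcup_(T in TT) T.
have UN : #|U| <= N * d.
  by apply: leq_trans (card_bigcup_leq TTd) _; rewrite leq_mul2r TTN orbT.
have [|A AU Ap] := @subset_of_card _ (~: (B :|: S :|: U)) p.
  rewrite cardsCs setCK card_ord.
  have := (leq_card_setU B S).1; have := (leq_card_setU (B :|: S) U).1; lia.
have dA (X : {set 'I_n}) : X \subset B :|: S :|: U -> A :&: X = set0.
  move=> XU; apply/eqP; rewrite setI_eq0 disjoints_subset.
  by apply: subset_trans AU _; rewrite setCS.
have AB : A :&: B = set0 by apply: dA; rewrite -setUA subsetUl.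
exists A; split=> //.
- by apply: dA; rewrite setUAC subsetUr.
- by move=> T TTt; apply: dA; rewrite subsetU // (bigcup_sup T) ?orbT.
have [|_ lb] := @beta_famP n p q Fam; first lia.
apply: leq_trans (lb (A, B) _) _; first by rewrite /admissible /= Ap Bq AB !eqxx.
by apply: subset_leq_card; apply/subsetP=> F; rewrite !inE => /andP[/(subsetP FM)->].
Qed.

(** * The upper bounds *)

Lemma restr_upset n k (M : {set {set 'I_n}}) (A B L F : {set 'I_n}) :
  uniform k M -> F \in restr M A B -> L \subset F -> F \in upset k (A :|: L) B.
Proof.
by move=> UM; rewrite !inE subUset => /and3P[/(uniformP UM)-> -> ->] ->; rewrite eqxx.
Qed.

Lemma card_disjointU n (A T : {set 'I_n}) p t :
  #|A| = p -> A :&: T = set0 -> #|T| = t -> #|A :|: T| = p + t.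
Proof. by move=> <- AT <-; rewrite cardsU AT cards0 subn0. Qed.

(** In the threshold, [k + k] makes blocking sets meet, the first bracket leaves room for A, and the
    second serves [cnt_step] with factor [k ^ 3]. *)
Lemma upper_bound1 n p k (Fam : {set {set 'I_n}}) :
  p + 2 <= k -> k + k + (p + 1 + k ^ 3 * 3 + 2) + (k ^ 3 * k + (p + 2) + 1) < n ->
  uniform k Fam -> intersecting Fam -> beta_fam p 1 Fam <= cnt n k 1 (p + 2).
Proof.
move=> pk large /maximal_extension h /h{h}[M [UM IM FM maxM]].
have k0 : 0 < k by lia.
have [TT [TTN TTF TTT]] := branching_basis 3 UM IM k0.
have TT3 T : T \in TT -> #|T| <= 3 by move/TTT=> [->//|[/ltnW]].
have meet S T : S \in TT -> T \in TT -> #|S| < 3 -> #|T| < 3 -> S :&: T != set0.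
  move=> /TTT[->//|[S3 tS]] /TTT[->//|[T3 tT]] _ _.
  by apply: (blocking_sets_meet maxM) => //; lia.
(* If [x] lies in all the small basis sets, take B = {x}: members off [x] contain basis sets of size
   3 only. *)
have [/existsP[x /forall_inP xTT]|noX] :=
  boolP [exists x, [forall T in TT, (#|T| < 3) ==> (x \in T)]].
  have [||A [Ap AB _ ATT le]] := @beta_fam_leq_restr n p 1 3 _ Fam M TT [set x] set0
    FM TTN TT3; rewrite ?cards1 ?cards0 //; first lia.
  apply: leq_trans le _.
  pose TT' := [set T in TT | #|T| == 3].
  apply: leq_trans (_ : #|TT'| * cnt n k #|[set x]| (p + 3) <= _).
    apply: (card_covered_leq (A := A)) => [F Fr|T].
      have FM' : F \in M by move: Fr; rewrite inE => /andP[].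
      have [T TTt TF] := TTF _ FM'; exists T; last exact: (restr_upset UM Fr TF).
      rewrite inE TTt; have /implyP := xTT _ TTt; case: (TTT _ TTt) => [->//|[T3 _] /(_ T3) xT].
      move: Fr; rewrite inE => /and3P[_ _ /eqP/setP/(_ x)].
      by rewrite !inE eqxx (subsetP TF _ xT).
    by rewrite inE => /andP[TTt /eqP T3]; apply: card_disjointU => //; apply: ATT.
  rewrite cards1; apply: leq_trans (_ : k ^ 3 * cnt n k 1 (p + 3) <= _).
    rewrite leq_mul2r (leq_trans _ TTN) ?orbT //.
    by apply: subset_leq_card; apply/subsetP=> T; rewrite inE => /andP[].
  by rewrite addnS cnt_step //; lia.
have {}noX x : exists2 T, T \in TT & (#|T| < 3) && (x \notin T).
  move: noX; rewrite negb_exists => /forallP/(_ x); rewrite negb_forall.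
  case/existsP=> T; rewrite !negb_imply => /andP[TTt xT]; by exists T.
(* The empty set does not meet itself, and a singleton {a} would put [a] in every small set. *)
have two T : T \in TT -> #|T| < 3 -> #|T| = 2.
  move=> TTt T3; case E: #|T| T3 => [|[|[|t]]] // _.
    have /set0Pn[x] := meet _ _ TTt TTt (ltac:(by rewrite E)) (ltac:(by rewrite E)).
    by rewrite (cards0_eq E) !inE.
  have /eqP/cards1P[a Ta] := E; have [S STT /andP[S3 aS]] := noX a.
  have /set0Pn[y] := meet _ _ TTt STT (ltac:(by rewrite E)) S3.
  by rewrite Ta !inE => /andP[/eqP->]; rewrite (negPf aS).
have n0 : 0 < n by lia.
have [T0 T0T /andP[T03 _]] := noX (Ordinal n0).
have /eqP/cards2P[a [b [ab T0E]]] := two _ T0T T03.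
have [T2 T2T /andP[T23 bT2]] := noX b.
have aT2 : a \in T2.
  have /set0Pn[y] := meet _ _ T0T T2T T03 T23.
  rewrite T0E !inE => /andP[/orP[] /eqP-> //]; by rewrite (negPf bT2).
have /eqP/cards1P[t T2a] : #|T2 :\ a| = 1.
  by have := cardsD1 a T2; rewrite aT2 (two _ T2T T23) => -[].
have tT2 : t \in T2 :\ a by rewrite T2a inE.
have bt : b != t by apply: contraNneq bT2 => ->; move: tT2; rewrite inE => /andP[].
(* [T0] = {a, b} and [T2] = {a, t} are blocking, so B = {a} forces both [b] and [t]. *)
have [||A [Ap AB AS ATT le]] := @beta_fam_leq_restr n p 1 3 _ Fam M TT [set a] [set b; t]
    FM TTN TT3; rewrite ?cards1 ?cards2 //; first by rewrite bt; lia.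
apply: leq_trans le _.
have := card_upset_leq k (A :|: [set b; t]) [set a].
rewrite (card_disjointU Ap AS (cards2 _ _)) bt cards1; apply: leq_trans.
apply: subset_leq_card; apply/subsetP=> F Fr.
apply: (restr_upset UM Fr); move: Fr; rewrite inE => /and3P[FM' _ /eqP/setP/(_ a)].
rewrite !inE eqxx /= => aF.
have tr T : T \in TT -> #|T| < 3 -> T :&: F != set0.
  by move=> /TTT[->//|[_ /blockingP tT]] _; apply: tT.
rewrite subUset !sub1set; apply/andP; split.
  have /set0Pn[y] := tr _ T0T T03; rewrite T0E !inE => /andP[/orP[] /eqP-> //].
  by rewrite aF.
have /set0Pn[y] := tr _ T2T T23; rewrite inE => /andP[yT2 yF].
have : y \in T2 :\ a by rewrite !inE yT2 andbT; apply: contraTneq yF => ->; rewrite aF.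
by rewrite T2a inE => /eqP <-.
Qed.

Lemma card_upset2 n k (A B L1 L2 : {set 'I_n}) :
  A :&: B = set0 -> B :&: L1 = set0 -> B :&: L2 = set0 ->
  #|upset k (A :|: L1) B :|: upset k (A :|: L2) B| +
    cnt n k #|B| #|A :|: (L1 :|: L2)| =
  cnt n k #|B| #|A :|: L1| + cnt n k #|B| #|A :|: L2|.
Proof.
move=> AB BL1 BL2.
have dB (X : {set 'I_n}) : B :&: X = set0 -> (A :|: X) :&: B = set0.
  by move=> BX; rewrite setIUl AB set0U setIC.
have BL : B :&: (L1 :|: L2) = set0 by rewrite setIUr BL1 BL2 setU0.
rewrite -(card_upset k (dB _ BL1)) -(card_upset k (dB _ BL2)) -(card_upset k (dB _ BL)).
apply: etrans (cardsUI _ _); congr (_ + _); apply: eq_card => F; rewrite !inE !subUset.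
by case: (_ == k); case: (A \subset F); case: (L1 \subset F); 
  case: (L2 \subset F); case: (B :&: F == set0).
Qed.

(** The summands provide, in turn, meeting blocking sets, room for A and for two triples, and the
    decay in [cnt_step] with factor [(k ^ 4).+1]. *)
Definition large2 p k :=
  k + k + (p + 2 + k ^ 4 * 4 + 6) + ((k ^ 4).+1 * k + (p + 5) + 2) + 7.

Lemma upper_bound2 n p k (Fam : {set {set 'I_n}}) :
  p + 3 <= k -> large2 p k < n ->
  uniform k Fam -> intersecting Fam ->
  beta_fam p 2 Fam + cnt n k 2 (p + 5) <= 2 * cnt n k 2 (p + 3).
Proof.
rewrite /large2 => pk large /maximal_extension h /h{h}[M [UM IM FM maxM]].
have k0 : 0 < k by lia.
have [TT [TTN TTF TTT]] := branching_basis 4 UM IM k0.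
have TT4 T : T \in TT -> #|T| <= 4 by move/TTT=> [->//|[/ltnW]].
pose H := [set T : {set 'I_n} | (#|T| <= 3) && blocking M T].
have meet S T : S \in H -> T \in H -> S :&: T != set0.
  rewrite !inE => /andP[S3 tS] /andP[T3 tT].
  by apply: (blocking_sets_meet maxM) => //; lia.
(* One triple contributes at most [cnt n k 2 (p + 3)]. The 4-sets contribute at most [k ^ 4] terms
   [cnt n k 2 (p + 4)]; the extra 1 in the factor [(k ^ 4).+1] absorbs [cnt n k 2 (p + 5)]. *)
have one_edge (B : {set 'I_n}) : #|B| = 2 ->
    (forall T, T \in H -> B :&: T = set0 -> #|T| = 3) ->
    #|[set T in H | B :&: T == set0]| <= 1 ->
    beta_fam p 2 Fam + cnt n k 2 (p + 5) <= 2 * cnt n k 2 (p + 3).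
  move=> B2 B3 B1.
  have [||A [Ap AB _ ATT le]] := @beta_fam_leq_restr n p 2 4 _ Fam M TT B set0
    FM TTN TT4; rewrite ?B2 ?cards0 //; first lia.
  pose TT1 := [set T in TT | (T \in H) && (B :&: T == set0)].
  pose TT2 := [set T in TT | #|T| == 4].
  pose G1 := [set F in restr M A B | [exists T in TT1, T \subset F]].
  pose G2 := [set F in restr M A B | [exists T in TT2, T \subset F]].
  have cov : restr M A B \subset G1 :|: G2.
    apply/subsetP=> F Fr; rewrite inE [F \in G1]inE [F \in G2]inE Fr /=.
    move: (Fr); rewrite inE => /and3P[FM' _ /eqP BF].
    have [T TTt TF] := TTF _ FM'.
    have BT : B :&: T == set0 by rewrite -subset0 -BF setIS.
    apply/orP; case: (TTT _ TTt) => [T4|[T3 tT]].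
      by right; apply/exists_inP; exists T => //; rewrite inE TTt T4.
    by left; apply/exists_inP; exists T => //; rewrite !inE TTt BT -ltnS T3 tT.
  have c1 : #|G1| <= #|TT1| * cnt n k #|B| (p + 3).
    apply: (card_covered_leq (A := A)) => [F|T].
      rewrite inE => /andP[Fr /exists_inP[T TT1t TF]]; exists T => //.
      exact: (restr_upset UM Fr TF).
    rewrite !inE => /and3P[TTt TH /eqP BT]; apply: card_disjointU => //; first exact: ATT.
    by apply: B3 => //; rewrite inE.
  have c2 : #|G2| <= #|TT2| * cnt n k #|B| (p + 4).
    apply: (card_covered_leq (A := A)) => [F|T].
      rewrite inE => /andP[Fr /exists_inP[T TT2t TF]]; exists T => //.
      exact: (restr_upset UM Fr TF).
    by rewrite !inE => /andP[TTt /eqP T4]; apply: card_disjointU => //; apply: ATT.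
  have t1 : #|TT1| <= 1.
    apply: leq_trans B1; apply: subset_leq_card; apply/subsetP=> T.
    by rewrite !inE => /andP[].
  have t2 : #|TT2| <= k ^ 4.
    by apply: leq_trans TTN; apply: subset_leq_card; apply/subsetP=> T; rewrite inE => /andP[].
  have e1 : #|TT1| * cnt n k 2 (p + 3) <= 1 * cnt n k 2 (p + 3) by rewrite leq_mul2r t1 orbT.
  have e2 : #|TT2| * cnt n k 2 (p + 4) <= k ^ 4 * cnt n k 2 (p + 4).
    by rewrite leq_mul2r t2 orbT.
  have s1 : (k ^ 4).+1 * cnt n k 2 (p + 4) <= cnt n k 2 (p + 3).
    by rewrite [p + 4]addnS cnt_step //; lia.
  have s2 : cnt n k 2 (p + 5) <= cnt n k 2 (p + 4) by apply: leq_cnt; lia.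
  move: c1 c2; rewrite B2 => c1 c2.
  have := leq_trans le (leq_trans (subset_leq_card cov) (leq_card_setU _ _)).
  move: s1; rewrite mulSn; lia.
(* A blocking set of size at most 2 extends to a pair B that every set in [H] meets. *)
have [/existsP[T /andP[TH T2]]|no2] := boolP [exists T, (T \in H) && (#|T| <= 2)].
  have [|B [TB _ B2]] := @superset_of_card _ T setT 2 (subsetT _).
    by rewrite T2 cardsT card_ord; lia.
  have noB S : S \in H -> B :&: S = set0 -> False.
    move=> SH BS; case/negP: (meet _ _ TH SH).
    by rewrite -subset0 -BS setSI.
  apply: (one_edge _ B2) => [S SH BS|]; first by case: (noB _ SH BS).
  rewrite leqNgt; apply/negP=> /ltnW/card_gt0P[S].
  by rewrite inE => /andP[SH /eqP]; apply: noB.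
have H3 T : T \in H -> #|T| = 3.
  move=> TH; move: no2; rewrite negb_exists => /forallP/(_ T); rewrite TH /= -ltnNge.
  by move: TH; rewrite inE => /andP[] *; apply/eqP; rewrite eqn_leq; apply/andP.
have [/existsP[x /existsP[y /andP[xy c1]]]|rob] := boolP [exists x, exists y,
    (x != y) && (#|[set T in H | [set x; y] :&: T == set0]| <= 1)].
  by apply: (one_edge [set x; y]) => // [|T /H3//]; rewrite cards2 xy.
have RH : robust_clique H.
  split=> // x y xy; move: rob; rewrite negb_exists => /forallP/(_ x).
  rewrite negb_exists => /forallP/(_ y); rewrite xy /= -ltnNge.
  case/card_gt1P=> e [f [eP fP ef]].
  have av g : g \in [set T in H | [set x; y] :&: T == set0] ->
      g \in H /\ (x \notin g) && (y \notin g).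
    rewrite inE => /andP[-> /eqP/setP xyg]; split=> //.
    by move: (xyg x) (xyg y); rewrite !inE !eqxx orbT /= => -> ->.
  by exists e, f; have [-> ->] := av _ eP; have [-> ->] := av _ fP.
have [|B [L1 [L2 [B2 [L13 L23] L12 L120 [BL1 BL2 trace]]]]] := robust_clique_trace RH.
  by rewrite card_ord; lia.
have [||A [Ap AB AS _ le]] := @beta_fam_leq_restr n p 2 4 _ Fam M TT B (L1 :|: L2)
    FM TTN TT4; rewrite ?B2 //.
  by have := (leq_card_setU L1 L2).1; rewrite L13 L23; lia.
have AL1 : A :&: L1 = set0 by apply/eqP; rewrite -subset0 -AS setIS // subsetUl.
have AL2 : A :&: L2 = set0 by apply/eqP; rewrite -subset0 -AS setIS // subsetUr.
have := card_upset2 k AB BL1 BL2.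
rewrite (card_disjointU Ap AL1 L13) (card_disjointU Ap AL2 L23) B2 addnn -mul2n => <-.
apply: leq_add.
  apply: leq_trans le _; apply: subset_leq_card; apply/subsetP=> F Fr; rewrite inE.
  move: (Fr); rewrite inE => /and3P[FM' _ /eqP BF].
  have [|//|LF|LF] := trace F; last 2 first.
  - by rewrite (restr_upset UM Fr LF).
  - by rewrite (restr_upset UM Fr LF) orbT.
  by move=> e; rewrite inE => /andP[_ /blockingP]; apply.
(* An inequality is enough, since a smaller union only increases the subtracted count. *)
have L125 : #|L1 :|: L2| <= 5.
  by have := cardsUI L1 L2; move: L120; rewrite -card_gt0 L13 L23; lia.
by have E := card_disjointU Ap AS (erefl _); apply: leq_cnt; lia.
Qed.

(** * The lower bounds: triangle and Fano plane *)

Definition points n (l : seq nat) : {set 'I_n} := [set v : 'I_n | val v \in l].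

Lemma card_points n (l : seq nat) :
  uniq l -> all (fun x => x < n) l -> #|points n l| = size l.
Proof.
move=> ul ln; have -> : points n l = [set v in (pmap insub l : seq 'I_n)].
  by apply/setP=> v; rewrite !inE mem_pmap_sub.
rewrite card_set_seq ?pmap_sub_uniq // size_pmap_sub; apply/eqP.
by rewrite -all_count.
Qed.

Lemma pointsU n (l1 l2 : seq nat) :
  points n l1 :|: points n l2 = points n (undup (l1 ++ l2)).
Proof. by apply/setP=> v; rewrite !inE mem_undup mem_cat. Qed.

Definition line_family n k (ls : seq (seq nat)) : {set {set 'I_n}} :=
  [set F : {set 'I_n} | (#|F| == k) && has (fun l => points n l \subset F) ls].

Lemma line_family_uniform n k ls : uniform k (line_family n k ls).
Proof. by apply/forall_inP=> F; rewrite inE => /andP[]. Qed.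

Lemma line_family_intersecting n k ls :
  all (fun l => all (fun l' => has (fun x => (x \in l') && (x < n)) l) ls) ls ->
  intersecting (line_family n k ls).
Proof.
move=> /allP ints; apply/forall_inP=> F; rewrite inE => /andP[_ /hasP[l lls lF]].
apply/forall_inP=> F'; rewrite inE => /andP[_ /hasP[l' lls' lF']].
have /allP/(_ _ lls') /= /hasP[x xl /andP[xl' xn]] := ints _ lls.
apply/set0Pn; exists (Ordinal xn); rewrite inE (subsetP lF) ?(subsetP lF') ?inE //.
Qed.

Lemma line_family_upset n k ls l (A B : {set 'I_n}) : l \in ls ->
  upset k (A :|: points n l) B \subset restr (line_family n k ls) A B.
Proof.
move=> lls; apply/subsetP=> F; rewrite !inE subUset => /and3P[-> /andP[-> lF] ->].
by rewrite !andbT /=; apply/hasP; exists l.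
Qed.

Lemma beta_lower_bound n p q k (Fam : {set {set 'I_n}}) m : p + q <= n ->
  uniform k Fam -> intersecting Fam ->
  (forall A B : {set 'I_n}, #|A| = p -> #|B| = q -> A :&: B = set0 ->
    m <= #|restr Fam A B|) -> m <= beta p q n k.
Proof.
move=> pqn UF IF mF; apply: (@bigmax_sup _ Fam); first by rewrite UF IF.
have [[[A B] /and3P[/eqP Ap /eqP Bq /eqP AB] ->] _] := beta_famP Fam pqn.
exact: mF.
Qed.

Definition triangle : seq (seq nat) := [:: [:: 0; 1]; [:: 1; 2]; [:: 0; 2]].

Lemma triangle_avoid x : has (fun l => x \notin l) triangle.
Proof. by case: x => [|[|[|x]]]. Qed.

(* The lines of the Fano plane as the translates of the perfect difference set
   {0, 1, 3} modulo 7. *)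
Definition fano : seq (seq nat) :=
  [:: [:: 0; 1; 3]; [:: 1; 2; 4]; [:: 2; 3; 5]; [:: 3; 4; 6]; [:: 4; 5; 0];
      [:: 5; 6; 1]; [:: 6; 0; 2]].

(** Each point is on three of the seven lines and two points share one, so at least two lines avoid
    [x] and [y]; distinct lines meet in one point. Beyond 6 all values behave alike, so 64 cases
    suffice. *)
Lemma fano_avoid x y : has (fun l1 => has (fun l2 =>
  [&& (x \notin l1) && (y \notin l1), (x \notin l2) && (y \notin l2)
    & size (undup (l1 ++ l2)) == 5]) fano) fano.
Proof.
by case: x => [|[|[|[|[|[|[|x]]]]]]]; case: y => [|[|[|[|[|[|[|y]]]]]]].
Qed.

Lemma points_disjoint n (B : {set 'I_n}) l :
  (forall v, v \in B -> val v \notin l) -> B :&: points n l = set0.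
Proof.
move=> Bl; apply/setP=> v; rewrite !inE; apply/negP=> /andP[/Bl vl].
by rewrite (negPf vl).
Qed.

Lemma lower_bound1 n p k : p + 2 <= k -> k + p + 5 <= n ->
  cnt n k 1 (p + 2) <= beta p 1 n k.
Proof.
move=> pk kn; have n3 : 2 < n by lia.
have [n0 n1] : 0 < n /\ 1 < n by lia.
apply: (@beta_lower_bound _ _ _ _ (line_family n k triangle)); first by lia.
- exact: line_family_uniform.
- by apply: line_family_intersecting; rewrite /= n0 n1 n3.
move=> A B Ap B1 AB; have /eqP/cards1P[b Bb] := B1.
have /hasP[l lt bl] := triangle_avoid (val b).
have l2 : #|points n l| = 2.
  by move: lt; rewrite !inE => /or3P[] /eqP->; rewrite card_points //= ?n0 ?n1 ?n3.
have BL : B :&: points n l = set0.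
  by apply: points_disjoint => v; rewrite Bb inE => /eqP->.
apply: leq_trans (subset_leq_card (line_family_upset k A B lt)).
rewrite card_upset ?B1; last by rewrite setIUl AB set0U setIC.
(* If A meets the edge, fewer points are required and the count only grows. *)
by have := (leq_card_setU A (points n l)).1; rewrite Ap l2 => h; apply: leq_cnt; lia.
Qed.

Lemma lower_bound2 n p k : p + 3 <= k -> 2 * k + k + p + 13 <= n ->
  2 * cnt n k 2 (p + 3) <= beta p 2 n k + cnt n k 2 (p + 5).
Proof.
move=> pk kn; have n7 i : i < 7 -> i < n by lia.
rewrite [beta _ _ _ _ + _]addnC -leq_subLR.
apply: (@beta_lower_bound _ _ _ _ (line_family n k fano)); first by lia.
- exact: line_family_uniform.
- by apply: line_family_intersecting; rewrite /= !n7.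
move=> A B Ap B2 AB; have /eqP/cards2P[x [y [xy Bxy]]] := B2.
have /hasP[l1 l1f /hasP[l2 l2f]] := fano_avoid (val x) (val y).
case/and3P=> /andP[xl1 yl1] /andP[xl2 yl2] /eqP l12.
have fano3 l : l \in fano -> #|points n l| = 3.
  move=> lf; suff /and3P[ul ln /eqP <-] : [&& uniq l, all (fun i => i < 7) l & size l == 3].
    by apply: card_points => //; apply: sub_all ln.
  by move: l lf; apply/allP.
have BL l : val x \notin l -> val y \notin l -> B :&: points n l = set0.
  by move=> xl yl; apply: points_disjoint => v; rewrite Bxy !inE => /orP[] /eqP->.
have [BL1 BL2] := (BL _ xl1 yl1, BL _ xl2 yl2).
have [L13 L23] := (fano3 _ l1f, fano3 _ l2f).
(* When A meets a line off B, that line alone suffices: at most p + 2 points are required, and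
   [cnt_step] with factor 2 applies. *)
have meets l : l \in fano -> B :&: points n l = set0 -> A :&: points n l != set0 ->
    2 * cnt n k 2 (p + 3) <= #|restr (line_family n k fano) A B|.
  move=> lf Bl; rewrite -card_gt0 => Al.
  apply: leq_trans (subset_leq_card (line_family_upset k A B lf)).
  rewrite card_upset ?B2; last by rewrite setIUl AB set0U setIC.
  have := cardsUI A (points n l); rewrite Ap (fano3 _ lf) => h.
  apply: leq_trans (_ : cnt n k 2 (p + 2) <= _); first by rewrite addnS cnt_step //; lia.
  by apply: leq_cnt; lia.
have [AL1|/meets h] := eqVneq (A :&: points n l1) set0; last first.
  by apply: leq_trans (leq_subr _ _) (h _ _).
have [AL2|/meets h] := eqVneq (A :&: points n l2) set0; last first.
  by apply: leq_trans (leq_subr _ _) (h _ _).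
have := card_upset2 k AB BL1 BL2.
have AL : A :&: (points n l1 :|: points n l2) = set0 by rewrite setIUr AL1 AL2 setU0.
have L5 : #|points n l1 :|: points n l2| = 5.
  rewrite pointsU -l12 card_points ?undup_uniq //.
  apply/allP=> i; rewrite mem_undup mem_cat => il; apply: n7.
  have f7 l : l \in fano -> i \in l -> i < 7.
    have : all (fun l => all (fun i => i < 7) l) fano by [].
    by move=> /allP h /h /allP; apply.
  by case/orP: il; apply: f7.
rewrite (card_disjointU Ap AL1 L13) (card_disjointU Ap AL2 L23) B2 (card_disjointU Ap AL L5).
rewrite addnn -mul2n => <-; rewrite addnK; apply: subset_leq_card.
by rewrite subUset !line_family_upset.
Qed.

(** * Assembly, with integer binomials *)

Local Open Scope ring_scope.

Theorem theorem1p5 :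
  (forall p k : nat, (p + 2 <= k)%N ->
     exists n0 : nat, forall n : nat, (n0 <= n)%N ->
       (beta p 1 n k)%:Z = binz (n - 3 - p)%N (k%:Z - 2 - p%:Z))
  /\
  (forall p k : nat, (p + 3 <= k)%N ->
     exists n0 : nat, forall n : nat, (n0 <= n)%N ->
       (beta p 2 n k)%:Z =
         2 * binz (n - 5 - p)%N (k%:Z - 3 - p%:Z)
         - binz (n - 7 - p)%N (k%:Z - 5 - p%:Z)).
Proof.
split=> p k pk.
  exists (k + k + (p + 1 + k ^ 3 * 3 + 2) + (k ^ 3 * k + (p + 2) + 1) + 6)%N => n nn.
  have -> : beta p 1 n k = cnt n k 1 (p + 2).
    apply/eqP; rewrite eqn_leq lower_bound1 ?andbT //; last by lia.
    by apply/bigmax_leqP=> Fam /andP[UF IF]; apply: upper_bound1 => //; lia.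
  have -> : k%:Z - 2 - p%:Z = Posz (k - (p + 2)) by lia.
  by rewrite /cnt pk /=; congr (Posz 'C(_, _)); lia.
exists (large2 p k + 2 * k + 20)%N => n nn.
(* The additive form avoids truncated subtraction. *)
have h : (beta p 2 n k + cnt n k 2 (p + 5) = 2 * cnt n k 2 (p + 3))%N.
  apply/eqP; rewrite eqn_leq lower_bound2 ?andbT //; last by move: nn; rewrite /large2; lia.
  suff : (beta p 2 n k <= 2 * cnt n k 2 (p + 3) - cnt n k 2 (p + 5))%N.
    have : (cnt n k 2 (p + 5) <= cnt n k 2 (p + 3))%N.
      by apply: leq_cnt; move: nn; rewrite /large2; lia.
    lia.
  apply/bigmax_leqP=> Fam /andP[UF IF].
  have : (beta_fam p 2 Fam + cnt n k 2 (p + 5) <= 2 * cnt n k 2 (p + 3))%N.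
    by apply: upper_bound2 => //; lia.
  lia.
have -> : binz (n - 5 - p)%N (k%:Z - 3 - p%:Z) = Posz (cnt n k 2 (p + 3)).
  have -> : k%:Z - 3 - p%:Z = Posz (k - (p + 3)) by lia.
  by rewrite /cnt pk /=; congr (Posz 'C(_, _)); lia.
have -> : binz (n - 7 - p)%N (k%:Z - 5 - p%:Z) = Posz (cnt n k 2 (p + 5)).
  (* For k < p + 5 both sides vanish: [cnt] by its test, [binz] by its negative branch, where
     [Negz m] is -(m+1). *)
  rewrite /cnt; case: leqP => kp.
    have -> : k%:Z - 5 - p%:Z = Posz (k - (p + 5)) by lia.
    by rewrite /=; congr (Posz 'C(_, _)); lia.
  by have -> : k%:Z - 5 - p%:Z = Negz (p + 4 - k) by lia.
lia.
Qed.
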